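(* For every finite connected weighted graph $G=(V,E,(c_{xy})_{xy\in E})$, every non-degenerate probability measure $\pi=(\pi(x))_{x\in V}$ on $V$ and every $k\in\mathbb N$, the spectral gap of the $k$-particle Binomial Splitting process $\mathrm{Bin}(k)$ coincides with that of the one-particle process: $$\mathrm{gap}_k=\mathrm{gap}_1 .$$
   Context: $G=(V,E,(c_{xy})_{xy\in E})$ is a finite, connected, undirected graph (edges are unordered pairs of distinct vertices) with positive symmetric edge weights $c_{xy}>0$. Non-degenerate means $\pi(x)>0$ for all $x\in V$, $\sum_x\pi(x)=1$. $\mathbb N=\{1,2,\dots\}$, $\mathbb N_0=\mathbb N\cup\{0\}$. Binomial Splitting process with $k$ particles, $\mathrm{Bin}(k)$: the continuous-time Markov chain on $\Omega_k=\{\xi\in\mathbb N_0^V:\sum_{x\in V}\xi(x)=k\}$ with generator $$\mathcal L^{\mathrm{Bin}(k)}f=\sum_{xy\in E}c_{xy}\big(\mathcal P^{\mathrm{Bin}(k)}_{xy}-\mathbf 1\big)f,\qquad \mathcal P^{\mathrm{Bin}(k)}_{xy}f(\xi)=\mathbb E\big[f(\Xi^{xy}_\xi)\big],\qquad f:\Omega_k\to\mathbb R,$$ where $\mathbf 1$ is the identity operator and the random configuration $\Xi^{xy}_\xi$ is given by $\Xi_\xi^{xy}(x)=Y$, $\Xi_\xi^{xy}(y)=\xi(x)+\xi(y)-Y$, $\Xi_\xi^{xy}(z)=\xi(z)$ for $z\ne x,y$, with $Y\sim\mathrm{Binomial}\big(\xi(x)+\xi(y),\frac{\pi(x)}{\pi(x)+\pi(y)}\big)$.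 The process is reversible with respect to the Multinomial$(k,\pi)$ distribution $\mu_{k,\pi}(\xi)=k!\prod_{x\in V}\frac{\pi(x)^{\xi(x)}}{\xi(x)!}$. The spectral gap is the smallest positive eigenvalue of $-\mathcal L^{\mathrm{Bin}(k)}$, i.e. $$\mathrm{gap}_k=\inf_{f\ne0:\ \mathbb E_{\mu_{k,\pi}}[f]=0}\frac{\mathbb E_{\mu_{k,\pi}}[f(-\mathcal L^{\mathrm{Bin}(k)}f)]}{\mathbb E_{\mu_{k,\pi}}[f^2]} .$$ *)

(* Defs.v *)
From HB Require Import structures.
From mathcomp Require Import all_boot all_order all_algebra.
From mathcomp Require Import boolp classical_sets reals constructive_ereal ereal.
From mathcomp Require Import binomial_distribution.

Set Implicit Arguments.
Unset Strict Implicit.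
Unset Printing Implicit Defensive.

Import Order.TTheory GRing.Theory Num.Theory.

Local Open Scope ring_scope.

Section Config.
Variables (V : finType) (k : nat).

(* Omega_k *)
Record config := Config {
  occ :> {ffun V -> nat};
  _ : (\sum_x occ x == k)%N }.

HB.instance Definition _ := [isSub for occ].
HB.instance Definition _ := [Countable of config by <:].

Lemma sum_occ (xi : config) : (\sum_x xi x)%N = k.
Proof. exact/eqP/(valP xi). Qed.

Lemma occ_le (xi : config) x : (xi x <= k)%N.
Proof. by rewrite -(sum_occ xi) (bigD1 x) //= leq_addr. Qed.

(* Finiteness of Omega_k: every coordinate is at most k. *)
Definition bounded_of_config (xi : config) : {ffun V -> 'I_k.+1} := [ffun x => inord (xi x)].
Definition config_of_bounded (g : {ffun V -> 'I_k.+1}) : option config :=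
  insub [ffun x => g x : nat].

Lemma bounded_of_configK : pcancel bounded_of_config config_of_bounded.
Proof.
move=> xi; rewrite /config_of_bounded.
have -> : [ffun x => bounded_of_config xi x : nat] = val xi.
  by apply/ffunP=> x; rewrite !ffunE inordK // ltnS occ_le.
exact: valK.
Qed.

HB.instance Definition _ := isFinite.Build config (pcan_enumP bounded_of_configK).

Definition split_occ (xi : config) (x y : V) (j : nat) : {ffun V -> nat} :=
  [ffun z => if z == x then j
             else if z == y then (xi x + xi y - j)%N
             else xi z].

(* The value of Xi^{xy}_xi on the event Y = j; the default value xi of insubd
   is only used outside the meaningful range, see [split_configE]. *)
Definition split_config (xi : config) (x y : V) (j : nat) : config :=
  insubd xi (split_occ xi x y j).

Lemma split_configE (xi : config) (x y : V) (j : nat) :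
  x != y -> (j <= xi x + xi y)%N -> split_config xi x y j = split_occ xi x y j :> {ffun V -> nat}.
Proof.
move=> xy jle; rewrite /split_config; apply: insubdK; apply/eqP.
have yx : y != x by rewrite eq_sym.
rewrite (bigD1 x) //= (bigD1 y) //= !ffunE eqxx (negPf yx) eqxx addnA subnKC //.
rewrite -[RHS](sum_occ xi) [RHS](bigD1 x) //= [X in (_ + X)%N = _](eq_bigr (fun z => xi z)).
  by rewrite [X in _ = (_ + X)%N](bigD1 y) //= addnA.
by move=> z /andP[zx zy]; rewrite ffunE (negPf zx) (negPf zy).
Qed.

End Config.

Section BinomialSplitting.
Variables (R : realType) (V : finType).
Variables (e : rel V) (c : V -> V -> R) (pi : V -> R) (k : nat).

Local Notation Omega := (config V k).

(* P_{xy} f (xi) = E[f(Xi^{xy}_xi)], Y ~ Binomial(xi x + xi y, pi x / (pi x + pi y)) *)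
Definition bin_split (x y : V) (f : Omega -> R) (xi : Omega) : R :=
  \sum_(j < (xi x + xi y).+1)
    binomial_pmf (xi x + xi y) (pi x / (pi x + pi y)) j
    * f (split_config xi x y j).

(* The summand is symmetric in x and y (see [bin_split_sym]), so the sum over
   unordered edges is half the sum over ordered pairs of adjacent vertices. *)
Definition bin_generator (f : Omega -> R) (xi : Omega) : R :=
  2^-1 * \sum_x \sum_(y | e x y) c x y * (bin_split x y f xi - f xi).

Definition multinomial (xi : Omega) : R :=
  k`!%:R * \prod_x (pi x ^+ xi x / (xi x)`!%:R).

Definition mean (f : Omega -> R) : R := \sum_xi multinomial xi * f xi.

(* The infimum is taken in the extended reals: if #|V| = 1 then no nonzero f
   has mean zero, and the gap is +oo. *)
Definition gap : \bar R :=
  ereal_inf [set r | exists f : Omega -> R,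
    [/\ f <> (fun=> 0),
        mean f = 0 &
        r = (mean (fun xi => f xi * - bin_generator f xi)
             / mean (fun xi => f xi ^+ 2))%:E]].

Lemma bin_split_sym (x y : V) (f : Omega -> R) :
  x != y -> 0 < pi x -> 0 < pi y -> bin_split x y f =1 bin_split y x f.
Proof.
move=> xy px py xi; rewrite /bin_split.
have yx : y != x by rewrite eq_sym.
have s0 : pi x + pi y != 0 by rewrite gt_eqF // addr_gt0.
have nE : (xi y + xi x = xi x + xi y)%N by rewrite addnC.
rewrite nE (reindex_inj rev_ord_inj) /=; apply: eq_bigr => -[j jlt] _ /=.
have jle : (j <= xi x + xi y)%N by rewrite -ltnS.
rewrite subSS; congr (_ * f _).
  have onemE (a b : R) : a + b != 0 -> unstable.onem (a / (a + b)) = b / (a + b).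
    by move=> ab0; rewrite /unstable.onem -[X in X - _](divff ab0) -mulrBl addrAC subrr add0r.
  rewrite /binomial_pmf bin_sub // subKn // mulrC.
  have s0' : pi y + pi x != 0 by rewrite addrC.
  by rewrite !onemE // [pi y + pi x]addrC.
apply: val_inj => /=; rewrite !split_configE ?leq_subr ?nE //.
apply/ffunP=> z; rewrite !ffunE nE subKn //.
by case: (eqVneq z x) => // ->; rewrite (negPf xy).
Qed.

End BinomialSplitting.

(* Main.v *)
Require Import Defs.
From mathcomp Require Import all_boot all_order all_algebra.
From mathcomp Require Import boolp classical_sets reals constructive_ereal ereal.
From mathcomp Require Import binomial_distribution.
From mathcomp Require Import ring lra.

Set Implicit Arguments.
Unset Strict Implicit.
Unset Printing Implicit Defensive.

Import Order.TTheory GRing.Theory Num.Theory.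

Local Open Scope ring_scope.

(** The spectral gap does not depend on [k] because the [k]-particle process is
a symmetrised tensor power of the one-particle process.  When the edge [xy]
rings, each of the particles at [x] or [y] independently chooses [x] or [y]
afresh, with probabilities proportional to [pi].  On one particle this is the
operator [edge_avg x y], which is an orthogonal projection of L^2(pi); on
labelled particles it is a tensor power of that projection.

Labels are avoided by peeling off one particle at a time.  A function [f] of
[k.+1] particles is read as the function (xi, z) |-> f (xi + delta_z) of [k]
particles and one more site.  In this reading the multinomial law is the
product of the [k]-particle law and [pi] ([mean_succ]), and the splitting
operator P_{k+1} is the product of P_k acting on [xi] and [edge_avg] acting on
[z] ([bin_split_add_particle], that is Pascal's rule for binomial laws).

For gap_1 <= gap_k, write f = g + h, where g = [last_mean f] integrates the last
particle out and h = [last_fluct f] has mean zero in it.  The two parts are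
orthogonal and the dynamics does not couple them.  On [h], since P_k is a
contraction and A = [edge_avg x y] is a projection,
<h, (P_k A) h> = <A h, P_k (A h)> <= <A h, A h> = <h, A h>,
so 1 - P_k A dominates 1 - A: the energy of [h] is at least its one-particle
energy in the last coordinate, to which the one-particle Poincare inequality
applies.  The energy of [g] is handled by induction on [k].  This is
[edge_corr_le_succ], summed over edges in [dirichlet_succ] and iterated in
[poincare_lift].

For gap_k <= gap_1, a centred function [u] on sites gives the observable
xi |-> \sum_x xi(x) u(x), whose energy and variance are both [k] times those of
[u] ([dirichlet_linear_obs], [mean_sqr_linear_obs]); the Rayleigh quotients
agree ([gap_test_linear]). *)

(** * Adding a particle to a configuration *)

Section AddParticle.
Variables (V : finType).

Definition add_occ (z : V) (n : {ffun V -> nat}) : {ffun V -> nat} :=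
  [ffun x => n x + (x == z)]%N.

Lemma sum_add_occ z n : (\sum_x add_occ z n x = (\sum_x n x).+1)%N.
Proof.
under eq_bigr do rewrite ffunE.
rewrite big_split /= -addn1; congr addn.
by rewrite (bigD1 z) //= eqxx big1 // => x /negPf->.
Qed.

Lemma add_particle_subproof k (z : V) (xi : config V k) :
  (\sum_x add_occ z xi x == k.+1)%N.
Proof. by rewrite sum_add_occ sum_occ. Qed.

Definition add_particle k (z : V) (xi : config V k) : config V k.+1 :=
  Config (add_particle_subproof z xi).

(** The result is an option because [z] may be empty in [zeta]; truncated
subtraction then leaves the wrong number of particles. *)
Definition remove_particle k (z : V) (zeta : config V k.+1) : option (config V k) :=
  insub [ffun x => zeta x - (x == z)]%N.

Lemma add_particleE k z (xi : config V k) x :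
  add_particle z xi x = (xi x + (x == z))%N.
Proof. by rewrite ffunE. Qed.

Lemma add_particleK k z : pcancel (@add_particle k z) (remove_particle z).
Proof.
move=> xi; rewrite /remove_particle.
have -> : [ffun x => add_particle z xi x - (x == z)]%N = val xi.
  by apply/ffunP=> x; rewrite !ffunE addnK.
exact: valK.
Qed.

Lemma remove_particleK k z (zeta : config V k.+1) : (0 < zeta z)%N ->
  omap (add_particle z) (remove_particle z zeta) = Some zeta.
Proof.
move=> zeta_z; set n := [ffun x => zeta x - (x == z)]%N.
have addn : add_occ z n = zeta :> {ffun V -> nat}.
  apply/ffunP=> x; rewrite !ffunE subnK //.
  by case: eqVneq => // ->.
have nk : (\sum_x n x == k)%N by rewrite -eqSS -(sum_add_occ z) addn sum_occ.
rewrite /remove_particle insubT /=; congr Some; exact: val_inj.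
Qed.

Lemma config_succ k (zeta : config V k.+1) :
  exists z xi, zeta = add_particle z xi.
Proof.
case: (pickP (fun z => 0 < zeta z)%N) => [z zeta_z|zeta0].
  have := remove_particleK zeta_z.
  by case: (remove_particle z zeta) => //= xi [<-]; exists z, xi.
have := sum_occ zeta; rewrite big1 // => x _.
by apply/eqP; rewrite -leqn0 leqNgt zeta0.
Qed.

Lemma config0_subproof : (\sum_x [ffun _ : V => 0] x == 0)%N.
Proof. by rewrite big1 // => x _; rewrite ffunE. Qed.

Definition config0 : config V 0 := Config config0_subproof.

Lemma config0E (xi : config V 0) : xi = config0.
Proof.
apply: val_inj; apply/ffunP=> x /=; rewrite ffunE.
by apply/eqP; rewrite -leqn0 (occ_le xi x).
Qed.

Lemma add_particle_edge k (xi : config V k) (x y z : V) :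
  x != y -> (z == x) || (z == y) ->
  (add_particle z xi x + add_particle z xi y = (xi x + xi y).+1)%N.
Proof.
move=> xy zxy; rewrite !add_particleE addnACA -addn1 !(eq_sym _ z); congr addn.
by case/orP: zxy => /eqP->; rewrite eqxx ?(negPf xy) // eq_sym (negPf xy).
Qed.

(** This lemma and the next two locate an added particle after the split: off
the edge it stays put, on the edge it is one more particle to distribute, so
sending it to [x] turns the count [j] into [j.+1] and sending it to [y] keeps
[j]. *)
Lemma split_config_add k (xi : config V k) (x y z : V) (j : nat) :
  x != y -> (j <= xi x + xi y)%N -> z != x -> z != y ->
  split_config (add_particle z xi) x y j = add_particle z (split_config xi x y j).
Proof.
move=> xy jle /negPf zx /negPf zy; apply: val_inj; apply/ffunP=> w /=.
rewrite split_configE // ?add_particleE; last by rewrite !(eq_sym _ z) zx zy !addn0.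
rewrite !ffunE split_configE // ffunE !(eq_sym _ z) zx zy !addn0.
have [->|wx] := eqVneq w x; first by rewrite zx addn0.
by have [->|//] := eqVneq w y; rewrite zy addn0.
Qed.

Lemma add_split_configl k (xi : config V k) (x y z : V) (j : nat) :
  x != y -> (j <= xi x + xi y)%N -> (z == x) || (z == y) ->
  add_particle x (split_config xi x y j) =
  split_config (add_particle z xi) x y j.+1.
Proof.
move=> xy jle zxy.
have n1 := add_particle_edge xi xy zxy.
apply: val_inj; apply/ffunP=> w /=.
rewrite [in RHS]split_configE ?n1 // [RHS]ffunE n1 subSS !ffunE split_configE // ffunE.
case: (eqVneq w x) => [_|wx]; first by rewrite addn1.
rewrite addn0; case: (eqVneq w y) => [//|wy]; rewrite (_ : w == z = false) ?addn0 //.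
by case/orP: zxy => /eqP->; rewrite ?(negPf wx) ?(negPf wy).
Qed.

Lemma add_split_configr k (xi : config V k) (x y z : V) (j : nat) :
  x != y -> (j <= xi x + xi y)%N -> (z == x) || (z == y) ->
  add_particle y (split_config xi x y j) =
  split_config (add_particle z xi) x y j.
Proof.
move=> xy jle zxy.
have n1 := add_particle_edge xi xy zxy.
apply: val_inj; apply/ffunP=> w /=.
rewrite [in RHS]split_configE ?n1 //; last exact: leqW.
rewrite [RHS]ffunE n1 subSn // !ffunE split_configE // ffunE.
have [->|wx] := eqVneq w x; first by rewrite (negPf xy) addn0.
case: (eqVneq w y) => [_|wy]; first by rewrite addn1.
rewrite addn0 (_ : w == z = false) ?addn0 //.
by case/orP: zxy => /eqP->; rewrite ?(negPf wx) ?(negPf wy).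
Qed.

End AddParticle.

(** * Decomposing the splitting operator and the multinomial law *)

Section BinomialSplittingGap.
Variables (R : realType).

(** A Binomial(n+1, p) variable is a Binomial(n, p) one plus an independent
Bernoulli(p) one; on the mass functions this is Pascal's rule. *)
Lemma sum_binomial_pmf_succ (n : nat) (p : R) (G : nat -> R) :
  \sum_(j < n.+2) binomial_pmf n.+1 p j * G j =
  \sum_(j < n.+1) binomial_pmf n p j * (p * G j.+1 + (1 - p) * G j).
Proof.
under [RHS]eq_bigr do rewrite mulrDr.
rewrite big_split /=.
pose q : R := 1 - p.
have tail : \sum_(j < n.+1) binomial_pmf n p j * ((1 - p) * G j) =
    \sum_(j < n.+2) (p ^+ j * q ^+ (n.+1 - j) *+ 'C(n, j)) * G j.
  rewrite [RHS]big_ord_recr /= bin_small // mulr0n mul0r addr0.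
  apply: eq_bigr => -[j jn] _ /=; rewrite /binomial_pmf.
  rewrite subSn // exprS /unstable.onem -/q; ring.
(* Both sums over [j < n.+2] now split off [j = 0], where Pascal's rule has
   no first term. *)
rewrite tail big_ord_recl [X in _ = _ + X]big_ord_recl /= !bin0 addrCA.
congr (_ + _).
rewrite -big_split /=; apply: eq_bigr => -[j jn] _ /=.
rewrite /binomial_pmf /bump /= add1n binS subSS /unstable.onem -/q exprS mulrnDr.
ring.
Qed.

Variables (V : finType) (pi : V -> R).
Hypothesis (pi_gt0 : forall x : V, 0 < pi x).

(** The one-particle splitting operator: conditional expectation under [pi] given
the partition of the sites that merges [x] and [y]. *)
Definition edge_avg (x y : V) (u : V -> R) (z : V) : R :=
  if (z == x) || (z == y) then (pi x * u x + pi y * u y) / (pi x + pi y)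
  else u z.

(** The splitting operator on [k.+1] particles is the product of the one on [k]
particles and of [edge_avg] acting on the added particle: that particle is
resplit independently of the others. *)
Lemma bin_split_add_particle k (x y z : V) (f : config V k.+1 -> R) (xi : config V k) :
  x != y ->
  bin_split pi x y f (add_particle z xi) =
  bin_split pi x y (fun xi' => edge_avg x y (fun w => f (add_particle w xi')) z) xi.
Proof.
move=> xy; rewrite /bin_split /edge_avg.
case: (boolP ((z == x) || (z == y))) => [zxy|/norP[zx zy]].
  have n1 := add_particle_edge xi xy zxy.
  rewrite n1 (sum_binomial_pmf_succ _ _
    (fun j => f (split_config (add_particle z xi) x y j))).
  apply: eq_bigr => -[j jn] _ /=.
  rewrite (add_split_configl xy _ zxy) // (add_split_configr xy _ zxy) //.
  congr (_ * _); field.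
  by rewrite gt_eqF // addr_gt0.
rewrite !add_particleE !(eq_sym _ z) (negPf zx) (negPf zy) !addn0.
by apply: eq_bigr => -[j jn] _ /=; rewrite split_config_add.
Qed.

(** Size-biasing: weighting a multinomial configuration by the fraction of its
particles that sit at [z] amounts to choosing one of its particles at [z]. *)
Lemma multinomial_add_particle k z (xi : config V k) :
  multinomial pi xi * pi z =
  multinomial pi (add_particle z xi) * (add_particle z xi z)%:R / k.+1%:R.
Proof.
rewrite /multinomial (bigD1 z) //= [in RHS](bigD1 z) //=.
rewrite [X in _ = _ * (_ * X) * _ / _]
  (eq_bigr (fun x => pi x ^+ xi x / (xi x)`!%:R)); last first.
  by move=> x xz; rewrite !add_particleE (negPf xz) addn0.
rewrite !add_particleE eqxx addn1 exprS !factS !natrM.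
have : ((xi z)`!%:R : R) != 0 by rewrite pnatr_eq0 -lt0n fact_gt0.
have : (k.+1%:R : R) != 0 by rewrite pnatr_eq0.
have : ((xi z).+1%:R : R) != 0 by rewrite pnatr_eq0.
move: (k`!%:R : R) (k.+1%:R : R) ((xi z)`!%:R : R) ((xi z).+1%:R : R) => a b c d d0 b0 c0.
move: (\prod_(_ | _) _) (pi z ^+ _) => P Q.
by field; rewrite b0 c0 d0.
Qed.

(** A multinomial sample of [k.+1] particles is one of [k] particles plus an
independent particle of law [pi]: insert 1 = \sum_z zeta(z) / (k+1) and apply
the size-biasing identity to each term. *)
Lemma mean_succ k (f : config V k.+1 -> R) :
  mean pi f = \sum_z pi z * mean pi (fun xi => f (add_particle z xi)).
Proof.
have -> : mean pi f = \sum_z \sum_(zeta : config V k.+1 | (0 < zeta z)%N)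
    (multinomial pi zeta * (zeta z)%:R / k.+1%:R) * f zeta.
  rewrite /mean; transitivity (\sum_(zeta : config V k.+1) \sum_z
     multinomial pi zeta * (zeta z)%:R / k.+1%:R * f zeta).
    apply: eq_bigr => zeta _.
    rewrite -mulr_suml; congr (_ * _).
    rewrite -mulr_suml -mulr_sumr -natr_sum sum_occ mulfK //.
  rewrite exchange_big; apply: eq_bigr => z _.
  rewrite [RHS]big_mkcond; apply: eq_bigr => zeta _.
  by case: (posnP (zeta z)) => [->|//]; rewrite mulr0 !mul0r.
apply: eq_bigr => z _.
rewrite (reindex_omap _ (remove_particle z) (@remove_particleK V k z)) /=.
rewrite /mean mulr_sumr; apply: eq_big => [xi|xi _].
  by rewrite add_particleE eqxx addn1 add_particleK eqxx.
by rewrite -multinomial_add_particle mulrA [pi z * _]mulrC.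
Qed.

(** * Means of observables *)

Lemma mean_add k (f g : config V k -> R) :
  mean pi (fun xi => f xi + g xi) = mean pi f + mean pi g.
Proof. by rewrite /mean -big_split; apply: eq_bigr => xi _; rewrite mulrDr. Qed.

Lemma mean_scale k a (f : config V k -> R) :
  mean pi (fun xi => a * f xi) = a * mean pi f.
Proof. by rewrite /mean mulr_sumr; apply: eq_bigr => xi _; rewrite mulrCA. Qed.

Lemma mean_sub k (f g : config V k -> R) :
  mean pi (fun xi => f xi - g xi) = mean pi f - mean pi g.
Proof. by rewrite /mean -sumrB; apply: eq_bigr => xi _; rewrite mulrBr. Qed.

Lemma mean_sum k (I : finType) (P : pred I) (f : I -> config V k -> R) :
  mean pi (fun xi => \sum_(i | P i) f i xi) = \sum_(i | P i) mean pi (f i).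
Proof.
rewrite /mean exchange_big; apply: eq_bigr => xi _.
by rewrite mulr_sumr.
Qed.

Lemma eq_mean k (f g : config V k -> R) : f =1 g -> mean pi f = mean pi g.
Proof. by move=> fg; congr mean; apply: funext. Qed.

Lemma multinomial_gt0 k (xi : config V k) : 0 < multinomial pi xi.
Proof.
rewrite mulr_gt0 ?ltr0n ?fact_gt0 // prodr_gt0 // => x _.
by rewrite divr_gt0 ?exprn_gt0 ?ltr0n ?fact_gt0.
Qed.

Lemma le_mean k (f g : config V k -> R) :
  (forall xi, f xi <= g xi) -> mean pi f <= mean pi g.
Proof.
by move=> fg; apply: ler_sum => xi _; rewrite ler_pM2l ?multinomial_gt0.
Qed.

Lemma mean_sqr_gt0 k (f : config V k -> R) :
  f <> (fun=> 0) -> 0 < mean pi (fun xi => f xi ^+ 2).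
Proof.
move=> f0; have ge0 xi : 0 <= multinomial pi xi * f xi ^+ 2.
  by rewrite mulr_ge0 ?sqr_ge0 // ltW ?multinomial_gt0.
rewrite lt0r sumr_ge0 // andbT; apply/eqP => /psumr_eq0P s0.
apply: f0; apply: funext => xi; apply/eqP; rewrite -sqrf_eq0.
have /eqP := s0 (fun xi _ => ge0 xi) xi isT.
by rewrite mulf_eq0 gt_eqF ?multinomial_gt0.
Qed.

Lemma mean_config0 (f : config V 0 -> R) : mean pi f = f (config0 V).
Proof.
rewrite /mean (bigD1 (config0 V)) //= big1 => [|xi]; last by rewrite [xi]config0E eqxx.
rewrite addr0 /multinomial big1 ?fact0 ?mulr1 ?mul1r // => x _.
by rewrite ffunE fact0 expr0 divr1.
Qed.

(** * The one-particle projection *)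

Definition expect (u : V -> R) : R := \sum_z pi z * u z.

Lemma expect_add u v : expect (fun z => u z + v z) = expect u + expect v.
Proof. by rewrite /expect -big_split; apply: eq_bigr => z _; rewrite mulrDr. Qed.

Lemma expect_scale a u : expect (fun z => a * u z) = a * expect u.
Proof. by rewrite /expect mulr_sumr; apply: eq_bigr => z _; rewrite mulrCA. Qed.

Lemma eq_expect u v : u =1 v -> expect u = expect v.
Proof. by move=> uv; congr expect; apply: funext. Qed.

Lemma mean_expect k (F : V -> config V k -> R) :
  \sum_z pi z * mean pi (F z) = mean pi (fun xi => expect (F^~ xi)).
Proof.
by rewrite mean_sum; apply: eq_bigr => z _; rewrite mean_scale.
Qed.

(** Conditional expectation is self-adjoint and idempotent in L^2(pi). *)
Lemma expect_mul_avg x y u v : x != y ->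
  expect (fun z => u z * edge_avg x y v z) =
  expect (fun z => edge_avg x y u z * edge_avg x y v z).
Proof.
move=> xy; have yx : y != x by rewrite eq_sym.
have s0 : pi x + pi y != 0 by rewrite gt_eqF ?addr_gt0.
rewrite /expect (bigD1 x) // (bigD1 y) //=.
rewrite [RHS](bigD1 x) // [X in _ = _ + X](bigD1 y) //=.
rewrite !addrA; congr (_ + _).
  by rewrite /edge_avg !eqxx !orbT /=; field.
by apply: eq_bigr => z /andP[zx zy]; rewrite /edge_avg (negPf zx) (negPf zy).
Qed.

Lemma edge_avg_const x y a z : edge_avg x y (fun=> a) z = a.
Proof.
rewrite /edge_avg; case: ifP => // _.
by rewrite -mulrDl mulrAC divff ?mul1r // gt_eqF ?addr_gt0.
Qed.

Lemma edge_avg_add x y u v z :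
  edge_avg x y (fun w => u w + v w) z = edge_avg x y u z + edge_avg x y v z.
Proof. by rewrite /edge_avg; case: ifP => // _; ring. Qed.

Lemma expect_edge_avg x y u : x != y -> expect (edge_avg x y u) = expect u.
Proof.
move=> xy; transitivity (expect (fun z => edge_avg x y u z * edge_avg x y (fun=> 1) z)).
  by apply: eq_expect => z; rewrite edge_avg_const mulr1.
rewrite -expect_mul_avg //.
by apply: eq_expect => z; rewrite edge_avg_const mulr1.
Qed.

Lemma expect_ge0 u : (forall z, 0 <= u z) -> 0 <= expect u.
Proof. by move=> u0; apply: sumr_ge0 => z _; rewrite mulr_ge0 // ltW. Qed.

(** The energy <u, (1 - A) u> of the edge for one particle, with A = [edge_avg x y];
it is in this form, |u|^2 - |A u|^2, that it bounds the energy of several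
particles from below. *)
Definition site_energy x y (u : V -> R) : R :=
  expect (fun z => u z ^+ 2) - expect (fun z => edge_avg x y u z ^+ 2).

(** Pythagoras: |u|^2 - |A u|^2 = |u - A u|^2 for an orthogonal projection A. *)
Lemma site_energy_ge0 x y u : x != y -> 0 <= site_energy x y u.
Proof.
move=> xy; have -> : site_energy x y u = expect (fun z => (u z - edge_avg x y u z) ^+ 2).
  rewrite /site_energy.
  have -> : expect (fun z => (u z - edge_avg x y u z) ^+ 2) =
      expect (fun z => u z ^+ 2 +
        ((-2) * (u z * edge_avg x y u z) + edge_avg x y u z ^+ 2)).
    by apply: eq_expect => z; ring.
  rewrite !expect_add expect_scale expect_mul_avg //.
  rewrite (@eq_expect (fun z => edge_avg x y u z * edge_avg x y u z)
    (fun z => edge_avg x y u z ^+ 2)); first by ring.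
  by move=> z; rewrite expr2.
by apply: expect_ge0 => z; rewrite sqr_ge0.
Qed.

(** * Energy of an edge: integrating out the last particle *)

(** The operators on the [k] particles and on the last one act on different
variables, hence commute. *)
Lemma bin_split_avg k x y (F : V -> config V k -> R) z xi :
  bin_split pi x y (fun xi' => edge_avg x y (F^~ xi') z) xi =
  edge_avg x y (fun w => bin_split pi x y (F w) xi) z.
Proof.
rewrite /edge_avg /bin_split; case: (_ || _) => //.
rewrite !mulr_sumr -big_split mulr_suml; apply: eq_bigr => j _ /=; ring.
Qed.

Lemma bin_split_sum k x y (I : finType) (a : I -> R) (F : I -> config V k -> R) xi :
  bin_split pi x y (fun xi' => \sum_i a i * F i xi') xi =
  \sum_i a i * bin_split pi x y (F i) xi.
Proof.
rewrite /bin_split; under [RHS]eq_bigr do rewrite mulr_sumr.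
rewrite [RHS]exchange_big; apply: eq_bigr => j _ /=.
by rewrite mulr_sumr; apply: eq_bigr => i _; rewrite mulrCA.
Qed.

Lemma bin_split_add k x y (f g : config V k -> R) xi :
  bin_split pi x y (fun xi' => f xi' + g xi') xi =
  bin_split pi x y f xi + bin_split pi x y g xi.
Proof. by rewrite /bin_split -big_split; apply: eq_bigr => j _; rewrite mulrDr. Qed.

Lemma bin_split_config0 x y (f : config V 0 -> R) xi : bin_split pi x y f xi = f xi.
Proof.
rewrite [xi]config0E /bin_split !ffunE big_ord1 /=.
rewrite /binomial_pmf bin0 !expr0 mulr1 mulr1n mul1r; congr f; exact: config0E.
Qed.

Lemma bin_split_const k x y a (xi : config V k) : x != y ->
  bin_split pi x y (fun=> a) xi = a.
Proof.
move=> xy; elim: k xi => [|k IH] xi; first exact: bin_split_config0.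
have [z [xi' ->]] := config_succ xi; rewrite bin_split_add_particle //.
by under eq_fun do rewrite edge_avg_const; exact: IH.
Qed.

Definition edge_corr k x y (f g : config V k -> R) : R :=
  mean pi (fun xi => f xi * bin_split pi x y g xi).

(** <F, (P A) F> = <A F, P (A F)>, because A is an orthogonal projection which
commutes with P. *)
Lemma edge_corr_succ k x y (f : config V k.+1 -> R) : x != y ->
  let B z xi := edge_avg x y (fun w => f (add_particle w xi)) z in
  edge_corr x y f f = \sum_z pi z * edge_corr x y (B z) (B z).
Proof.
move=> xy /=; rewrite /edge_corr mean_succ !mean_expect.
apply: eq_mean => xi.
under eq_expect do rewrite bin_split_add_particle // bin_split_avg.
rewrite expect_mul_avg //; apply: eq_expect => z.
by rewrite bin_split_avg.
Qed.

(** The splitting operator is at most the identity: it is a tensor power of a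
projection, so the bound is gained one particle at a time. *)
Lemma edge_corr_le k x y (f : config V k -> R) : x != y ->
  edge_corr x y f f <= mean pi (fun xi => f xi ^+ 2).
Proof.
move=> xy; elim: k f => [|k IH] f.
  by rewrite /edge_corr !mean_config0 bin_split_config0 expr2.
rewrite edge_corr_succ // mean_succ.
apply: (@le_trans _ _ (\sum_z pi z * mean pi (fun xi : config V k =>
    edge_avg x y (fun w => f (add_particle w xi)) z ^+ 2))).
  by apply: ler_sum => z _; rewrite ler_pM2l.
rewrite !mean_expect; apply: le_mean => xi.
by rewrite -subr_ge0 site_energy_ge0.
Qed.

Hypothesis pi_sum : \sum_x pi x = 1.

Lemma expect_const a : expect (fun=> a) = a.
Proof. by rewrite /expect -mulr_suml pi_sum mul1r. Qed.

Definition last_mean k (f : config V k.+1 -> R) (xi : config V k) : R :=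
  expect (fun w => f (add_particle w xi)).

Definition last_fluct k (f : config V k.+1 -> R) (xi : config V k) (w : V) : R :=
  f (add_particle w xi) - last_mean f xi.

Lemma expect_last_fluct k (f : config V k.+1 -> R) xi :
  expect (last_fluct f xi) = 0.
Proof.
by rewrite expect_add expect_const subrr.
Qed.

Lemma mean_last_mean k (f : config V k.+1 -> R) :
  mean pi (last_mean f) = mean pi f.
Proof. by rewrite mean_succ mean_expect. Qed.

Lemma mean_sqr_succ k (f : config V k.+1 -> R) :
  mean pi (fun zeta => f zeta ^+ 2) =
  mean pi (fun xi => last_mean f xi ^+ 2) +
  mean pi (fun xi => expect (fun w => last_fluct f xi w ^+ 2)).
Proof.
rewrite mean_succ mean_expect -mean_add; apply: eq_mean => xi.
have -> : expect (fun w => f (add_particle w xi) ^+ 2) =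
  expect (fun w => last_mean f xi ^+ 2 + ((2 * last_mean f xi) * last_fluct f xi w +
    last_fluct f xi w ^+ 2)).
  by apply: eq_expect => w; rewrite /last_fluct; ring.
by rewrite !expect_add expect_const expect_scale expect_last_fluct mulr0 add0r.
Qed.

(** The comparison at the heart of the proof.  The part [last_mean f] contributes
exactly its own correlation; the cross terms vanish because the fluctuation
has mean zero in the last particle, a property which both operators preserve;
for the fluctuation, the operator on the other [k] particles is bounded by the
identity. *)
Lemma edge_corr_le_succ k x y (f : config V k.+1 -> R) : x != y ->
  edge_corr x y f f <= edge_corr x y (last_mean f) (last_mean f) +
    mean pi (fun xi => expect (fun z => edge_avg x y (last_fluct f xi) z ^+ 2)).
Proof.
move=> xy; rewrite edge_corr_succ //.
set g := last_mean f; pose b z xi := edge_avg x y (last_fluct f xi) z.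
have b0 xi : expect (b^~ xi) = 0 by rewrite expect_edge_avg // expect_last_fluct.
(* Averaging fixes [g xi], which does not depend on the last particle. *)
have Bgb z : (fun xi => edge_avg x y (fun w => f (add_particle w xi)) z) =
    (fun xi => g xi + b z xi).
  apply: funext => xi; rewrite -[g xi](edge_avg_const x y _ z) -edge_avg_add.
  by congr edge_avg; apply: funext => w; rewrite /last_fluct /g addrC subrK.
have -> : \sum_z pi z * edge_corr x y
    (fun xi => edge_avg x y (fun w => f (add_particle w xi)) z)
    (fun xi => edge_avg x y (fun w => f (add_particle w xi)) z) =
    edge_corr x y g g + \sum_z pi z * edge_corr x y (b z) (b z).
  rewrite !mean_expect -mean_add; apply: eq_mean => xi.
  have Pb0 : expect (fun z => bin_split pi x y (b z) xi) = 0.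
    rewrite /expect -bin_split_sum -[RHS](bin_split_const 0 xi xy).
    by congr bin_split; apply: funext => xi'; exact: b0.
  transitivity (expect (fun z => g xi * bin_split pi x y g xi +
      (g xi * bin_split pi x y (b z) xi + (bin_split pi x y g xi * b z xi +
       b z xi * bin_split pi x y (b z) xi)))).
    apply: eq_expect => z; rewrite Bgb bin_split_add.
    by have /= -> := congr1 (fun F => F xi) (Bgb z); ring.
  by rewrite !expect_add expect_const !expect_scale Pb0 b0 !mulr0 !add0r.
rewrite lerD2l -mean_expect; apply: ler_sum => z _; rewrite ler_pM2l //.
exact: edge_corr_le.
Qed.

(** * Dirichlet forms and the lower bound on the gap *)

Variables (e : rel V) (c : V -> V -> R).
Hypotheses (e_irr : irreflexive e) (c_gt0 : forall x y, e x y -> 0 < c x y).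

Lemma edge_neq x y : e x y -> x != y.
Proof. by apply: contraTneq => ->; rewrite e_irr. Qed.

Definition dirichlet k (f : config V k -> R) : R :=
  2^-1 * \sum_x \sum_(y | e x y)
    c x y * (mean pi (fun xi => f xi ^+ 2) - edge_corr x y f f).

Definition site_dirichlet (u : V -> R) : R :=
  2^-1 * \sum_x \sum_(y | e x y) c x y * site_energy x y u.

Lemma mean_mul_generator k (f : config V k -> R) :
  mean pi (fun xi => f xi * - bin_generator e c pi f xi) = dirichlet f.
Proof.
rewrite /dirichlet /edge_corr.
under [in RHS]eq_bigr => x _.
  under eq_bigr => y _.
    rewrite -mean_sub -mean_scale.
    over.
  rewrite -mean_sum; over.
rewrite -mean_sum -mean_scale; apply: eq_mean => xi.
rewrite /bin_generator -mulrN mulrCA; congr (_ * _).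
rewrite -sumrN mulr_sumr; apply: eq_bigr => x _.
rewrite -sumrN mulr_sumr; apply: eq_bigr => y _.
by ring.
Qed.

Lemma dirichlet_succ k (f : config V k.+1 -> R) :
  dirichlet (last_mean f) + mean pi (fun xi => site_dirichlet (last_fluct f xi))
  <= dirichlet f.
Proof.
rewrite /site_dirichlet mean_scale -mulrDr ler_pM2l ?invr_gt0 ?ltr0n //.
rewrite mean_sum -big_split; apply: ler_sum => x _.
rewrite mean_sum -big_split; apply: ler_sum => y exy /=.
rewrite mean_scale -mulrDr ler_pM2l ?c_gt0 //.
have := edge_corr_le_succ f (edge_neq exy).
rewrite mean_sqr_succ /site_energy mean_sub; lra.
Qed.

Lemma dirichlet_ge0 k (f : config V k -> R) : 0 <= dirichlet f.
Proof.
rewrite mulr_ge0 // sumr_ge0 // => x _; rewrite sumr_ge0 // => y exy.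
by rewrite mulr_ge0 ?(ltW (c_gt0 exy)) // subr_ge0 edge_corr_le // edge_neq.
Qed.

Lemma site_dirichlet_ge0 u : 0 <= site_dirichlet u.
Proof.
rewrite mulr_ge0 // sumr_ge0 // => x _; rewrite sumr_ge0 // => y exy.
by rewrite mulr_ge0 ?(ltW (c_gt0 exy)) // site_energy_ge0 // edge_neq.
Qed.

(** Any one-particle Poincare constant is a [k]-particle one: each peeled particle
pays for its own fluctuation. *)
Lemma poincare_lift (lam : R) :
  (forall u, expect u = 0 -> lam * expect (fun z => u z ^+ 2) <= site_dirichlet u) ->
  forall k (f : config V k -> R), mean pi f = 0 ->
  lam * mean pi (fun xi => f xi ^+ 2) <= dirichlet f.
Proof.
move=> site; elim=> [|k IH] f f0.
  move: f0; rewrite !mean_config0 => ->.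
  by rewrite expr0n mulr0 dirichlet_ge0.
apply: le_trans (dirichlet_succ f).
rewrite mean_sqr_succ mulrDr lerD ?IH ?mean_last_mean //.
rewrite -mean_scale; apply: le_mean => xi.
by apply: site; exact: expect_last_fluct.
Qed.

(** * Linear observables and the upper bound on the gap *)

Definition linear_obs k (u : V -> R) (xi : config V k) : R :=
  \sum_x (xi x)%:R * u x.

Lemma linear_obs_add k u z (xi : config V k) :
  linear_obs u (add_particle z xi) = linear_obs u xi + u z.
Proof.
rewrite /linear_obs.
under eq_bigr do rewrite add_particleE natrD mulrDl.
rewrite big_split /=; congr (_ + _).
by rewrite (bigD1 z) //= eqxx mul1r big1 ?addr0 // => x /negPf->; rewrite mul0r.
Qed.

Lemma linear_obs0 u : linear_obs u (config0 V) = 0.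
Proof. by rewrite /linear_obs big1 // => x _; rewrite ffunE mul0r. Qed.

Lemma mean_const k a : mean pi (fun _ : config V k => a) = a.
Proof.
elim: k => [|k IH]; first by rewrite mean_config0.
by rewrite mean_succ IH -mulr_suml pi_sum mul1r.
Qed.

Lemma mean_linear_obs k u : expect u = 0 -> mean pi (@linear_obs k u) = 0.
Proof.
move=> u0; elim: k => [|k IH]; first by rewrite mean_config0 linear_obs0.
rewrite mean_succ mean_expect -[RHS]IH; apply: eq_mean => xi.
under eq_expect do rewrite linear_obs_add.
by rewrite expect_add expect_const u0 addr0.
Qed.

(** The particles are independent, so centred summands are uncorrelated and only
the [k] diagonal terms remain. *)
Lemma mean_linear_obs_mul k u v : expect u = 0 -> expect v = 0 ->
  mean pi (fun xi : config V k => linear_obs u xi * linear_obs v xi) =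
  k%:R * expect (fun z => u z * v z).
Proof.
move=> u0 v0; elim: k => [|k IH].
  by rewrite mean_config0 linear_obs0 !mul0r.
rewrite mean_succ mean_expect -natr1 mulrDl mul1r -IH.
rewrite -[X in _ = _ + X](mean_const k) -mean_add; apply: eq_mean => xi.
transitivity (expect (fun z => linear_obs u xi * linear_obs v xi +
   (linear_obs u xi * v z + (linear_obs v xi * u z + u z * v z)))).
  by apply: eq_expect => z; rewrite !linear_obs_add; ring.
by rewrite !expect_add expect_const !expect_scale u0 v0 !mulr0 !add0r.
Qed.

(** The particles evolve marginally as single particles, so linear observables
are preserved. *)
Lemma bin_split_linear_obs k x y u (xi : config V k) : x != y ->
  bin_split pi x y (linear_obs u) xi = linear_obs (edge_avg x y u) xi.
Proof.
move=> xy; elim: k xi => [|k IH] xi.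
  by rewrite bin_split_config0 [xi]config0E !linear_obs0.
have [z [xi' ->]] := config_succ xi; rewrite bin_split_add_particle // linear_obs_add -IH.
rewrite -[X in _ = _ + X](bin_split_const _ xi' xy) -bin_split_add.
congr bin_split; apply: funext => xi2.
rewrite -[X in _ = X + _](edge_avg_const x y _ z) -edge_avg_add.
by congr edge_avg; apply: funext => w; rewrite linear_obs_add.
Qed.

Lemma mean_sqr_linear_obs k u : expect u = 0 ->
  mean pi (fun xi : config V k => linear_obs u xi ^+ 2) =
  k%:R * expect (fun z => u z ^+ 2).
Proof. by move=> u0; rewrite -[RHS]mean_linear_obs_mul. Qed.

Lemma dirichlet_linear_obs k u : expect u = 0 ->
  dirichlet (@linear_obs k u) = k%:R * site_dirichlet u.
Proof.
move=> u0; rewrite /dirichlet /site_dirichlet mulrCA; congr (_ * _).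
rewrite mulr_sumr; apply: eq_bigr => x _.
rewrite mulr_sumr; apply: eq_bigr => y exy.
have xy := edge_neq exy.
rewrite mulrCA; congr (_ * _); rewrite mean_sqr_linear_obs // /site_energy mulrBr.
congr (_ - _); rewrite /edge_corr; under eq_mean do rewrite bin_split_linear_obs //.
by rewrite mean_linear_obs_mul ?expect_edge_avg // expect_mul_avg.
Qed.

(** Every one-particle observable is linear, which identifies functions of a
single particle with functions of its site. *)
Lemma linear_obs1 (f : config V 1 -> R) :
  f = linear_obs (fun z => f (add_particle z (config0 V))).
Proof.
apply: funext => zeta; have [z [xi ->]] := config_succ zeta.
by rewrite linear_obs_add [xi]config0E linear_obs0 add0r.
Qed.

Lemma expect_mean1 (f : config V 1 -> R) :
  expect (fun z => f (add_particle z (config0 V))) = mean pi f.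
Proof. by rewrite mean_succ; apply: eq_bigr => z _; rewrite mean_config0. Qed.

Lemma expect_sqr_gt0 u : expect u = 0 -> u <> (fun=> 0) ->
  0 < expect (fun z => u z ^+ 2).
Proof.
move=> u0 un0.
have -> : expect (fun z => u z ^+ 2) =
    mean pi (fun xi : config V 1 => linear_obs u xi ^+ 2).
  by rewrite mean_sqr_linear_obs // mul1r.
apply: mean_sqr_gt0 => lin0; apply: un0; apply: funext => z.
have := congr1 (fun f => f (add_particle z (config0 V))) lin0.
by rewrite linear_obs_add linear_obs0 add0r.
Qed.

(** For every positive number of particles, linear observables have the Rayleigh
quotient of their one-particle profile, as [k] cancels. *)
Lemma gap_test_linear k u : (0 < k)%N -> expect u = 0 -> u <> (fun=> 0) ->
  (gap e c pi k <= (site_dirichlet u / expect (fun z => (u z ^+ 2)%R))%:E)%E.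
Proof.
move=> k0 u0 un0; have kn0 : (k%:R : R) != 0 by rewrite pnatr_eq0 -lt0n.
have sq_gt0 := expect_sqr_gt0 u0 un0.
apply: ereal_inf_lbound; exists (@linear_obs k u); split.
- move=> lin0; have := mean_sqr_linear_obs k u0; rewrite lin0 expr0n mean_const => /eqP.
  by rewrite eq_sym mulf_eq0 (negPf kn0) (gt_eqF sq_gt0).
- exact: mean_linear_obs.
rewrite mean_mul_generator dirichlet_linear_obs // mean_sqr_linear_obs //.
by congr EFin; rewrite -mulf_div divff // mul1r.
Qed.

Lemma gap_le_gap1 k : (0 < k)%N -> (gap e c pi k <= gap e c pi 1)%E.
Proof.
move=> k0; apply/ereal_infP => _ [f [f0 mf0 ->]].
set u := fun z => f (add_particle z (config0 V)).
have fu : f = linear_obs u by exact: linear_obs1.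
have u0 : expect u = 0 by rewrite expect_mean1.
rewrite mean_mul_generator fu dirichlet_linear_obs // mean_sqr_linear_obs // !mul1r.
apply: gap_test_linear => // uz; apply: f0; rewrite fu uz.
by apply: funext => xi; rewrite /linear_obs big1 // => x _; rewrite mulr0.
Qed.

Lemma site_poincare (lam : R) u : (lam%:E <= gap e c pi 1)%E -> expect u = 0 ->
  lam * expect (fun z => u z ^+ 2) <= site_dirichlet u.
Proof.
move=> lam_gap u0; have [u_eq0|un0] := pselect (u = fun=> 0).
  rewrite [X in lam * X](_ : _ = 0) ?mulr0 ?site_dirichlet_ge0 //.
  by rewrite u_eq0 -[RHS]expect_const; apply: eq_expect => z; rewrite expr0n.
have := le_trans lam_gap (gap_test_linear (ltn0Sn 0) u0 un0).
by rewrite lee_fin ler_pdivlMr ?expect_sqr_gt0.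
Qed.

Lemma gap1_le_gap k : (gap e c pi 1 <= gap e c pi k)%E.
Proof.
apply/ereal_infP => _ [f [f0 mf0 ->]]; rewrite mean_mul_generator.
set q := dirichlet f / _.
have le_q lam : (lam%:E <= gap e c pi 1)%E -> lam <= q.
  move=> lam_gap; rewrite ler_pdivlMr ?mean_sqr_gt0 //.
  by apply: poincare_lift mf0 => u; exact: site_poincare.
case: (gap e c pi 1) le_q => [r|//|] le_q; last exact: leNye.
  by rewrite lee_fin le_q.
(* An infinite one-particle gap would make q + 1 a lower bound of q. *)
by have := le_q (q + 1) (leey _); rewrite gerDl ler10.
Qed.

End BinomialSplittingGap.

(** * The spectral gap is the one-particle gap *)

Theorem theorem2p1 (R : realType) (V : finType)
    (e : rel V) (e_sym : symmetric e) (e_irr : irreflexive e)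
    (e_conn : forall x y : V, connect e x y)
    (c : V -> V -> R) (c_sym : forall x y : V, c x y = c y x)
    (c_gt0 : forall x y : V, e x y -> 0 < c x y)
    (pi : V -> R) (pi_gt0 : forall x : V, 0 < pi x) (pi_sum : \sum_x pi x = 1)
    (k : nat) (k_gt0 : (0 < k)%N) :
  gap e c pi k = gap e c pi 1.
Proof.
by apply/le_anti/andP; split; [exact: gap_le_gap1 | exact: gap1_le_gap].
Qed.
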